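(* Let $\mathfrak P=(S,\mathcal L)$ be a thick, nondegenerate, embeddable polar space of rank at least $3$, and let $W$ be a (proper) subspace of $\mathfrak P$ that is contained in a hyperplane of $\mathfrak P$. Then $\mathfrak P$ can be recovered in the complement $\mathfrak M(\mathfrak P,W)$; that is, the points and lines of $\mathfrak P$ together with their incidence can be defined purely in terms of the point-line incidence structure $\mathfrak M(\mathfrak P,W)$, so that $\mathfrak P$ is isomorphic to a point-line structure constructed from $\mathfrak M(\mathfrak P,W)$ alone.
   Context: A partial linear space is a pair $(S,\mathcal L)$, $\mathcal L\subseteq 2^S$ (points and lines), where two distinct lines share at most one point and each line has at least $2$ points; thick: each line has at least $3$ points. A subspace is a subset containing every line meeting it in at least two points; a hyperplane is a proper subspace meeting every line. A polar space is a partial linear space satisfying: for every line $L$ and point $a\notin L$, $a$ is collinear with exactly one or with all points of $L$. Nondegenerate: no point is collinear with all other points. Rank: maximal length $n$ of a chain $\emptyset\ne X_1\subsetneq\dots\subsetneq X_n$ of singular subspaces (subspaces whose points are pairwise collinear). Embeddable: there is an injective map from $S$ into the point set of a projective space mapping every line of $\mathfrak P$ onto the full point set of a projective line. The complement of $W$ is the partial linear space $\mathfrak M(\mathfrak P,W)=(S\setminus W,\{k\setminus W: k\in\mathcal L,\ k\not\subseteq W\})$. *)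

(* Defs.v *)
From mathcomp Require Import all_boot.
From mathcomp Require Import boolp classical_sets.

Set Implicit Arguments.
Unset Strict Implicit.
Unset Printing Implicit Defensive.

Local Open Scope classical_set_scope.

Record pointLine := PointLine { pt :> Type; line : set (set pt) }.

Definition partial_linear (P : pointLine) : Prop :=
  (forall k l : set P, line k -> line l -> k <> l ->
     forall x y, (k `&` l) x -> (k `&` l) y -> x = y) /\
  (forall k : set P, line k -> exists x y, [/\ k x, k y & x <> y]).

Definition thick (P : pointLine) : Prop :=
  forall k : set P, line k ->
    exists x y z, [/\ k x, k y & k z] /\ [/\ x <> y, y <> z & x <> z].

(* Only ever applied to distinct points. *)
Definition collinear (P : pointLine) (x y : P) : Prop :=
  exists k : set P, [/\ line k, k x & k y].

Definition subspace (P : pointLine) (X : set P) : Prop :=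
  forall k : set P, line k ->
    (exists x y, [/\ (k `&` X) x, (k `&` X) y & x <> y]) -> k `<=` X.

Definition hyperplane (P : pointLine) (H : set P) : Prop :=
  [/\ subspace H, H <> setT & forall k : set P, line k -> k `&` H !=set0].

Definition singular (P : pointLine) (X : set P) : Prop :=
  forall x y, X x -> X y -> x <> y -> collinear x y.

Definition polar_space (P : pointLine) : Prop :=
  partial_linear P /\
  (forall (k : set P) (a : P), line k -> ~ k a ->
     (exists! b, k b /\ collinear a b) \/ (forall b, k b -> collinear a b)).

Definition nondegenerate (P : pointLine) : Prop :=
  ~ exists a : P, forall b, b <> a -> collinear a b.

Definition singular_chain (P : pointLine) (n : nat) : Prop :=
  exists X : nat -> set P,
    (forall i, (i < n)%N -> [/\ X i !=set0, subspace (X i) & singular (X i)]) /\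
    (forall i, (i.+1 < n)%N -> X i `<` X i.+1).

Definition has_rank (P : pointLine) (n : nat) : Prop :=
  singular_chain P n /\ (forall m, singular_chain P m -> (m <= n)%N).

(* Veblen-Young axioms: two points on a unique line, lines with at least three
   points, and two lines m, n that both cross two lines k, l through p, away
   from p, intersect each other. *)
Definition projective_space (Q : pointLine) : Prop :=
  [/\ partial_linear Q,
      thick Q,
      forall x y : Q, x <> y -> collinear x y
    & forall (p : Q) (k l m n : set Q),
        [/\ line k, line l, line m & line n] ->
        k <> l -> k p -> l p -> ~ m p -> ~ n p ->
        k `&` m !=set0 -> l `&` m !=set0 ->
        k `&` n !=set0 -> l `&` n !=set0 ->
        m `&` n !=set0].

Definition embeddable (P : pointLine) : Prop :=
  exists (Q : pointLine) (f : P -> Q),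
    [/\ projective_space Q, injective f
      & forall k : set P, line k -> line (f @` k)].

Definition complement (P : pointLine) (W : set P) : pointLine :=
  @PointLine (set_type (~` W))
    [set m | exists k : set P,
       [/\ line k, ~ (k `<=` W) & m = [set x | k (val x)]]].

Definition isomorphic (P Q : pointLine) : Prop :=
  exists f : P -> Q,
    bijective f /\ (forall k : set P, line k <-> line (f @` k)).

(* "Definable in terms of the incidence structure M" is read as parameter-free
   first-order interpretability.  M is viewed as a one-sorted structure: its
   elements are its points and its lines, its relations are "is a point", "is
   incident with" and equality.  The formulas do not mention M, so they give a
   construction that is uniform in M and sees only its incidence relation. *)

(* [formula n]: first-order formulas with free variables in 'I_n; the variable
   bound by [FEx] is number 0. *)
Inductive formula : nat -> Type :=
| FPoint n (i : 'I_n) : formula n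
| FEq n (i j : 'I_n) : formula n
| FInc n (i j : 'I_n) : formula n
| FNot n (f : formula n) : formula n
| FAnd n (f g : formula n) : formula n
| FEx n (f : formula n.+1) : formula n.

Definition elt (M : pointLine) : Type := (pt M + set_type (@line M))%type.

Definition is_point (M : pointLine) (x : elt M) : Prop :=
  if x is inl _ then True else False.

Definition incident (M : pointLine) (x y : elt M) : Prop :=
  if (x, y) is (inl a, inr k) then val k a else False.

Fixpoint holds (M : pointLine) n (f : formula n) : n.-tuple (elt M) -> Prop :=
  match f in formula n return n.-tuple (elt M) -> Prop with
  | FPoint _ i => fun e => is_point (tnth e i)
  | FEq _ i j => fun e => tnth e i = tnth e j
  | FInc _ i j => fun e => incident (tnth e i) (tnth e j)
  | FNot _ f => fun e => ~ holds f e
  | FAnd _ f g => fun e => holds f e /\ holds g e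
  | FEx _ f => fun e => exists x : elt M, holds f (cons_tuple x e)
  end.

Record interpretation := Interpretation {
  pt_arity : nat;
  ln_arity : nat;
  pt_dom : formula pt_arity;
  pt_equiv : formula (pt_arity + pt_arity);
  ln_dom : formula ln_arity;
  pt_on_ln : formula (pt_arity + ln_arity) }.

(* The class of s.  Nothing forces [pt_equiv] to be an equivalence; equality
   of two such sets is first-order expressible in any case. *)
Definition pt_class (I : interpretation) (M : pointLine)
    (s : (pt_arity I).-tuple (elt M)) : set ((pt_arity I).-tuple (elt M)) :=
  [set t | holds (pt_dom I) t /\ holds (pt_equiv I) (cat_tuple s t)].

(* No equality formula for lines is needed: lines are sets of points. *)
Definition interpreted (I : interpretation) (M : pointLine) : pointLine :=
  @PointLine
    (set_type [set C | exists2 s, holds (pt_dom I) s & C = @pt_class I M s])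
    [set m | exists2 u, holds (ln_dom I) u &
       m = [set C | exists2 s, val C s & holds (pt_on_ln I) (cat_tuple s u)]].

(* Main.v *)
Require Import Defs.
From mathcomp Require Import all_boot.
From mathcomp Require Import boolp classical_sets.

(* Collinearity determines a nondegenerate polar space: points are separated
   by their perps, and the line ab is {a, b}^perpperp.  So it suffices to code
   the points of P by tuples of elements of the complement of W in such a way
   that collinearity of the coded points is definable.
   - A line k leaving W meets W iff some point off W is collinear with no point
     of k off W.  If k meets W in w, a point x off W is collinear with w iff x
     is not collinear with exactly one point of k off W.
   - Call u deep if u^perp is contained in W.  Every other point w of W lies on
     a line leaving W and is determined by w^perp off W, so it is coded by the
     lines through it, and equality of codes is definable.
   - For w, v in W, w not deep: w is collinear with v iff no point off W is
     collinear with both, or some line through w leaving W lies in v^perp.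
   - A proper subspace containing u^perp equals it, so there is at most one deep
     point u, and then W = u^perp; it is collinear with all points of W and
     with no others.  It exists iff W meets every line and there are distinct
     nondeep w, v in W without a common neighbour off W: for such w, v the line
     k = wv satisfies k^perp <= W; were no point of k deep, maximality of the
     perps in the residues of the points of k would give W = k^perp, which does
     not meet every line. *)

Set Implicit Arguments.
Unset Strict Implicit.
Unset Printing Implicit Defensive.

Local Open Scope classical_set_scope.

Local Notation "x ⊥ y" := (@collinear _ x y) (at level 50).

(** * Polar spaces *)

Section PolarSpace.
Variable P : pointLine.
Hypothesis polarP : polar_space P.
Hypothesis thickP : thick P.
Implicit Types (k l m : set P) (a b p q u v w x y z : P).

Lemma collinear_sym x y : x ⊥ y -> y ⊥ x.
Proof. by move=> [k [lk kx ky]]; exists k. Qed.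

Lemma collinear_on k x y : line k -> k x -> k y -> x ⊥ y.
Proof. by move=> lk kx ky; exists k. Qed.

Lemma line_eq k l x y : line k -> line l -> x <> y ->
  k x -> k y -> l x -> l y -> k = l.
Proof.
move=> lk ll xy kx ky lx ly; apply: contrapT => kl; apply: xy.
by have [[H _] _] := polarP; apply: (H k l).
Qed.

Lemma collinear_all k a x y : line k -> k x -> k y -> x <> y ->
  a ⊥ x -> a ⊥ y -> forall z, k z -> a ⊥ z.
Proof.
move=> lk kx ky xy ax ay; have [ka z kz|ka] := pselect (k a).
  exact: (collinear_on lk).
have [_ /(_ k a lk ka)[[b [_ ub]]|//]] := polarP.
by case: xy; rewrite -(ub x) // -(ub y).
Qed.

Lemma collinear_some k a : line k -> exists2 b, k b & a ⊥ b.
Proof.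
move=> lk; have [ka|ka] := pselect (k a).
  by exists a => //; apply: (collinear_on lk).
have [[_ two] /(_ k a lk ka)[[b [[kb ab] _]]|all]] := polarP; first by exists b.
by have [x [y [kx _ _]]] := two k lk; exists x => //; apply: all.
Qed.

Lemma third_point k a b : line k -> exists c, [/\ k c, c <> a & c <> b].
Proof.
move=> lk; have [x [y [z [[kx ky kz] [xy yz xz]]]]] := thickP lk.
have [xa|xa] := pselect (x = a); have [xb|xb] := pselect (x = b);
have [ya|ya] := pselect (y = a); have [yb|yb] := pselect (y = b);
  subst; try tauto;
  solve [by exists x | by exists y | exists z; split=> //; congruence].
Qed.

Lemma subspace_line (X : set P) k x y : subspace X -> line k -> x <> y ->
  k x -> k y -> X x -> X y -> k `<=` X.
Proof. by move=> sX lk xy kx ky Xx Xy; apply: sX => //; exists x, y. Qed.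

Lemma subspaceT : subspace [set: P].
Proof. by []. Qed.

Definition nondeg_on (X : set P) := forall x, X x -> exists2 y, X y & ~ x ⊥ y.

(* With p, q not collinear, this represents the residue of p. *)
Definition perp2 (X : set P) p q : set P := [set z | [/\ X z, z ⊥ p & z ⊥ q]].

Lemma subspace_perp2 X p q : subspace X -> subspace (perp2 X p q).
Proof.
move=> sX k lk [x [y [[kx [Xx xp xq]] [ky [Xy yp yq]] xy]]] z kz; split.
- exact: (subspace_line sX lk xy).
- by apply: collinear_sym; apply: (collinear_all lk kx ky xy) => //;
    apply: collinear_sym.
- by apply: collinear_sym; apply: (collinear_all lk kx ky xy) => //;
    apply: collinear_sym.
Qed.

Hypothesis collinear_refl : forall x, x ⊥ x.

(** If x <> y, take [t] off y^perp, its neighbour [b] on the line xy, and [z] off b^perp. The line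
    bt carries a neighbour [u] of [z], not collinear with [x]; the line zu carries a neighbour [v]
    of [x], hence of [y] and of [b]. So [b] is collinear with [u] and [v], thus with [z]. *)
Lemma perp_inj_on X x y : subspace X -> nondeg_on X -> X x -> X y ->
  (forall z, X z -> x ⊥ z -> y ⊥ z) -> x = y.
Proof.
move=> sX nX Xx Xy xy; apply: contrapT => nxy.
have [l [ll lx ly]] := collinear_sym (xy _ Xx (collinear_refl x)).
have lX := subspace_line sX ll nxy lx ly Xx Xy.
have [t Xt nyt] := nX _ Xy.
have [b lb tb] := collinear_some t ll.
have Xb := lX _ lb.
have nxt : ~ x ⊥ t by move=> /(xy _ Xt).
have [z Xz nbz] := nX _ Xb.
have bt : b <> t by move=> E; apply: nyt; rewrite -E; apply: (collinear_on ll).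
have [n [ln nt nb]] := tb.
have [u nu zu] := collinear_some z ln.
have Xu : X u by apply: (subspace_line sX ln bt).
have ub : u <> b by move=> E; apply/nbz/collinear_sym; rewrite -E.
have nxu : ~ x ⊥ u.
  move=> xu; apply: nxt; apply: (collinear_all ln nu nb) => //.
  exact: (collinear_on ll).
have bu : b ⊥ u by apply: (collinear_on ln).
have zu' : z <> u by move=> E; apply: nbz; rewrite E.
have [o [lo oz ou]] := zu.
have [v ov xv] := collinear_some x lo.
have Xv : X v by apply: (subspace_line sX lo zu').
have vu : v <> u by move=> E; apply: nxu; rewrite -E.
apply: nbz; apply: (collinear_all lo ov ou) => //.
apply: collinear_sym; apply: (collinear_all ll lx ly nxy) => //;
  apply: collinear_sym => //; exact: xy.
Qed.

(** If [r] were collinear with all of {p, q}^perp, then with every line through [p], as each carries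
    a neighbour of [q]; so p^perp would lie in r^perp, forcing p = r. *)
Lemma nondeg_perp2 X p q : subspace X -> nondeg_on X -> X p -> X q -> ~ p ⊥ q ->
  nondeg_on (perp2 X p q).
Proof.
move=> sX nX Xp Xq pq r [Xr rp rq]; apply: contrapT => N.
suff E : p = r by apply: pq; rewrite E.
apply: (perp_inj_on sX) => // s Xs [l [ll lp ls]].
have [s' ls' qs'] := collinear_some q ll.
have ps' : p <> s' by move=> E; apply/pq/collinear_sym; rewrite E.
have [->//|ps] := pselect (s = p).
apply: (collinear_all ll lp ls') => //; apply: contrapT => nrs; apply: N.
exists s' => //; split; last exact: collinear_sym.
- exact: (subspace_line sX ll ps).
- exact: (collinear_on ll).
Qed.

(** Lines through [z] meet u^perp, so [W] contains z^perp too, and a point off [W] turns out to be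
    collinear with all of {u, z}^perp. A line joining it to some [p] in that set has a second point
    off [W], so [p] is collinear with all of {u, z}^perp, against nondegeneracy. *)
Lemma perp_maximal_on X (W : set P) u z : subspace X -> nondeg_on X ->
  X u -> X z -> (exists c, [/\ X c, c <> u & u ⊥ c]) ->
  subspace W -> (forall x, X x -> u ⊥ x -> W x) -> W z -> ~ u ⊥ z ->
  X `<=` W.
Proof.
move=> sX nX Xu Xz [c [Xc cu uc]] sW uW Wz uz t Xt; apply: contrapT => Wt.
have zW x : X x -> z ⊥ x -> W x.
  have [->//|xz] := pselect (x = z).
  move=> Xx [l [ll lz lx]]; have [b lb ub] := collinear_some u ll.
  have zb : z <> b by move=> E; apply: uz; rewrite E.
  have Xb : X b by apply: (subspace_line sX ll xz).
  by apply: (subspace_line sW ll zb) => //; apply: uW.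
have [p [Xp pu pz]] : perp2 X u z !=set0.
  have [l [ll lu lc]] := uc; have [p lp zp] := collinear_some z ll.
  exists p; split; last exact: collinear_sym.
    by apply: (subspace_line sX ll cu).
  exact: (collinear_on ll).
(* A line through a point t off W meets u^perp and z^perp in the same point. *)
have same s b : X s -> ~ W s -> X b -> s ⊥ b -> u ⊥ b -> z ⊥ b.
  move=> Xs Ws Xb [l [ll ls lb]] ub; have Wb := uW _ Xb ub.
  have sb : s <> b by move=> E; apply: Ws; rewrite E.
  have [c' lc' zc'] := collinear_some z ll.
  have Xc' : X c' by apply: (subspace_line sX ll sb).
  apply: contrapT => zb; have bc' : b <> c' by move=> E; apply: zb; rewrite E.
  by apply: Ws; apply: (subspace_line sW ll bc') => //; apply: zW.
have perpX s r : X s -> ~ W s -> perp2 X u z r -> s ⊥ r.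
  move=> Xs Ws [Xr ru rz]; have [l [ll lr lu]] := ru.
  have [b lb sb] := collinear_some s ll.
  have ur : u <> r by move=> E; apply: uz; rewrite {1}E.
  have Xb : X b by apply: (subspace_line sX ll ur).
  have ub : u ⊥ b by apply: (collinear_on ll).
  have zb := same _ _ Xs Ws Xb sb ub.
  have [<-//|br] := pselect (b = r).
  case: uz; apply: collinear_sym; apply: (collinear_all ll lb lr) => //.
  exact: collinear_sym.
have Wp : W p by apply: uW => //; apply: collinear_sym.
have tp : t <> p by move=> E; apply: Wt; rewrite E.
have [l [ll lt lp]] : t ⊥ p by apply: perpX.
have [s [ls st sp]] := third_point t p ll.
have Xs : X s by apply: (subspace_line sX ll tp).
have Ws : ~ W s by move=> Ws; apply: Wt; apply: (subspace_line sW ll sp).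
have [r Yr] := nondeg_perp2 sX nX Xu Xz uz (And3 Xp pu pz).
apply; apply: collinear_sym.
by apply: (collinear_all ll ls lt) => //; apply: collinear_sym; apply: perpX.
Qed.

Hypothesis nondegP : nondegenerate P.

Lemma nondegT : nondeg_on [set: P].
Proof.
move=> x _; apply: contrapT => N; apply: nondegP; exists x => y _.
by apply: contrapT => xy; apply: N; exists y.
Qed.

Lemma perp_inj x y : (forall z, x ⊥ z -> y ⊥ z) -> x = y.
Proof.
by move=> xy; apply: (perp_inj_on subspaceT nondegT) => // z _; apply: xy.
Qed.

(* In the residue of w, the points k and wz satisfy (wz)^perp </= k^perp. *)
Lemma perp_separation k w z : line k -> k w -> ~ k z -> z ⊥ w ->
  exists y, [/\ y ⊥ w, y ⊥ z & ~ forall x, k x -> y ⊥ x].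
Proof.
move=> lk kw kz [l [ll lz lw]].
have [q _ wq] := nondegT (I : [set: P] w).
have [a ka qa] := collinear_some q lk; have [b lb qb] := collinear_some q ll.
have wb : w <> b by move=> E; apply/wq/collinear_sym; rewrite E.
have zw : z <> w by move=> E; apply: kz; rewrite E.
have sX := @subspace_perp2 _ w q subspaceT.
have nX := nondeg_perp2 subspaceT nondegT (I : [set: P] w) (I : [set: P] q) wq.
apply: contrapT => N.
suff E : b = a by apply: kz; rewrite (line_eq lk ll wb) // E.
apply: (perp_inj_on sX nX).
- split=> //; last exact: collinear_sym.
  exact: (collinear_on ll).
- split=> //; last exact: collinear_sym.
  exact: (collinear_on lk).
move=> y [_ yw yq] /collinear_sym yb; apply: contrapT => ay; apply: N.
exists y; split=> //; last by move=> /(_ _ ka)/collinear_sym.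
exact: (collinear_all ll lw lb wb).
Qed.

(** If [c] is off [k], then [b] is off the line ac, and [perp_separation] gives a common neighbour
    of [a] and [b] that is not collinear with all of ac, hence not with [c]. *)
Lemma line_perp_perp k a b c : line k -> k a -> k b -> a <> b ->
  (forall y, y ⊥ a -> y ⊥ b -> y ⊥ c) -> k c.
Proof.
move=> lk ka kb ab H; apply: contrapT => kc.
have [l [ll la lc]] : a ⊥ c by apply: H => //; apply: (collinear_on lk).
have lb : ~ l b by move=> lb; apply: kc; rewrite (line_eq lk ll ab).
have ba : b ⊥ a by apply: (collinear_on lk).
have [y [ya yb []]] := perp_separation ll la lb ba.
have ac : a <> c by move=> E; apply: kc; rewrite -E.
by apply: (collinear_all ll la lc) => //; apply: H.
Qed.

(** A singular plane, given as a point and a line in its perp not through it; rank at least 3 enters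
    in this form. *)
Definition on_plane p := exists2 m, line m & ~ m p /\ forall x, m x -> p ⊥ x.

Lemma line_on_plane p k : on_plane p -> line k -> k p ->
  exists2 z, ~ k z & forall x, k x -> z ⊥ x.
Proof.
move=> [m lm [mp pm]] lk kp; have [x [kx xp _]] := third_point p p lk.
have [y my xy] := collinear_some x lm.
have [ky|ky] := pselect (k y); last first.
  exists y => // t; apply: (collinear_all lk kp kx) => //; first by congruence.
    by apply: collinear_sym; apply: pm.
  exact: collinear_sym.
have [y' [my' y'y _]] := third_point y y lm.
have py : p <> y by move=> E; apply: mp; rewrite E.
exists y'.
  by move=> ky'; apply: mp; rewrite (line_eq lm lk y'y).
move=> t; apply: (collinear_all lk kp ky) => //.
  by apply: collinear_sym; apply: pm.
exact: (collinear_on lm).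
Qed.

(** If [p] and [q] are collinear, a plane on the line pq serves both. Otherwise two lines through
    [p] in the plane each carry a neighbour of [q], and these two neighbours span a line in
    q^perp. *)
Lemma on_plane_all p q : on_plane p -> on_plane q.
Proof.
move=> gp; have [<-//|npq] := pselect (p = q).
have [[k [lk kp kq]]|pq] := pselect (p ⊥ q).
  have [z kz zk] := line_on_plane gp lk kp.
  have [m [lm mz mp]] := zk _ kp; exists m => //.
  have zp : z <> p by move=> E; apply: kz; rewrite E.
  split=> [mq|]; first by apply: kz; rewrite (line_eq lk lm npq).
  apply: (collinear_all lm mz mp) => //; last exact: (collinear_on lk).
  by apply: collinear_sym; apply: zk.
have [m lm [mp pm]] := gp.
have [a' [ma' _ _]] := third_point p p lm.
have [b' [mb' ba' _]] := third_point a' a' lm.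
have [k [lk kp ka']] := pm _ ma'; have [l [ll lp lb']] := pm _ mb'.
have [a ka qa] := collinear_some q lk; have [b lb qb] := collinear_some q ll.
have pa : p <> a by move=> E; apply/pq/collinear_sym; rewrite E.
have pb : p <> b by move=> E; apply/pq/collinear_sym; rewrite E.
have ab : a <> b.
  move=> E; apply: mp; subst b; have kl := line_eq lk ll pa kp ka lp lb.
  by rewrite (line_eq lm lk ba') // kl.
have pa' : p <> a' by move=> E; apply: mp; rewrite E.
have pb' : p <> b' by move=> E; apply: mp; rewrite E.
have ab' : a ⊥ b'.
  apply: collinear_sym; apply: (collinear_all lk kp ka') => //.
    exact: (collinear_on ll).
  exact: (collinear_on lm).
have [n [ln na nb]] : a ⊥ b.
  by apply: (collinear_all ll lp lb') => //; apply: (collinear_on lk).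
exists n => //; split; last exact: (collinear_all ln na nb).
move=> nq; apply: pq; apply: (collinear_all ln na nb) => //.
  exact: (collinear_on lk).
exact: (collinear_on ll).
Qed.

Hypothesis planeP : exists p, on_plane p.

Lemma plane_on k : line k -> exists2 z, ~ k z & forall x, k x -> z ⊥ x.
Proof.
move=> lk; have [p /on_plane_all gp] := planeP.
by have [x [_ [_ [[kx _ _] _]]]] := thickP lk; apply: (line_on_plane (gp x)).
Qed.

Lemma line_through p : exists2 k, line k & k p.
Proof. by have [k [lk kp _]] := collinear_refl p; exists k. Qed.

(** * Proper subspaces and their deep points *)

Section Complement.
Variable W : set P.
Hypothesis subW : subspace W.
Hypothesis properW : W <> setT.

Definition deep u := forall x, u ⊥ x -> W x.

(** The neighbours of [w] outside k^perp generate w^perp: a neighbour in k^perp off [k] lies on a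
    line with two points outside k^perp, by [perp_separation], and a point of [k] lies on a line
    with two neighbours of [w] off [k]. *)
Lemma deep_of_perp k w : line k -> k w ->
  (forall y, y ⊥ w -> ~ (forall x, k x -> y ⊥ x) -> W y) -> deep w.
Proof.
move=> lk kw H.
have off z : z ⊥ w -> ~ k z -> W z.
  move=> zw kz; have [zk|] := pselect (forall x, k x -> z ⊥ x); last exact: H.
  have [y [yw yz yk]] := perp_separation lk kw kz zw.
  have [l [ll ly lz]] := yz.
  have nyz : y <> z by move=> E; apply: yk; rewrite E.
  have [t [lt ty tz]] := third_point y z ll.
  have tw : t ⊥ w.
    by apply: collinear_sym; apply: (collinear_all ll ly lz) => //;
       apply: collinear_sym.
  have tk : ~ (forall x, k x -> t ⊥ x).
    move=> tk; apply: yk => x kx; apply: collinear_sym.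
    by apply: (collinear_all ll lt lz tz) => //; apply: collinear_sym; auto.
  by apply: (subspace_line subW ll ty) => //; apply: H.
move=> x wx; have [kx|] := pselect (k x); last exact/off/collinear_sym.
have [z kz zk] := plane_on lk; have [l [ll lz lx]] := zk _ kx.
have [t [lt tx tz]] := third_point x z ll.
have xz : x <> z by move=> E; apply: kz; rewrite -E.
apply: (subspace_line subW ll tz) => //; apply: off => //.
- apply: collinear_sym; apply: (collinear_all ll lx lz) => //.
  exact/collinear_sym/zk.
- by move=> kt; apply: kz; rewrite (line_eq lk ll tx).
- exact: zk.
Qed.

(** The neighbour [x] off [W] shows that [w] is not deep, so [deep_of_perp] yields a neighbour [y]
    of [w] off [W] whose only neighbour on [k] is [w]. *)
Lemma affine_witness k w x : line k -> k w -> W w -> k x -> ~ W x ->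
  exists y, [/\ ~ W y, y ⊥ w & forall z, k z -> ~ W z -> ~ y ⊥ z].
Proof.
move=> lk kw Ww kx Wx; apply: contrapT => N; apply: Wx.
have wx : w ⊥ x by apply: (collinear_on lk).
apply: (deep_of_perp lk kw) wx => y yw yk; apply: contrapT => Wy; apply: N.
exists y; split=> // z kz Wz yz; apply: yk; apply: (collinear_all lk kw kz) => //.
by move=> E; apply: Wz; rewrite -E.
Qed.

Lemma affine_line_at w : ~ deep w -> exists k x, [/\ line k, k w, k x & ~ W x].
Proof.
move=> nd; apply: contrapT => N; apply: nd => x [k [lk kw kx]].
by apply: contrapT => Wx; apply: N; exists k, x.
Qed.

(** If w <> v are collinear, every neighbour of [w] off [W] lies in the perp of the line wv, making
    [w] deep. If they are not, a line through [w] leaving [W] has two points off [W], both collinear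
    with [v], so [v] is collinear with [w] after all. *)
Lemma perp_off_inj w v : W w -> W v -> ~ deep w ->
  (forall x, ~ W x -> x ⊥ w <-> x ⊥ v) -> w = v.
Proof.
move=> Ww Wv nd H; apply: contrapT => wv.
have [[k [lk kw kv]]|nc] := pselect (w ⊥ v).
  apply/nd/(deep_of_perp lk kw) => y yw yk; apply: contrapT => Wy.
  by apply: yk; apply: (collinear_all lk kw kv) => //; apply/H.
have [k [x [lk kw kx Wx]]] := affine_line_at nd.
have [y [ky yx yw]] := third_point x w lk.
have Wy : ~ W y by move=> Wy; apply: Wx; apply: (subspace_line subW lk yw).
apply/nc/collinear_sym/(collinear_all lk kx ky) => //; first by congruence.
  by apply/collinear_sym/H => //; apply: (collinear_on lk).
by apply/collinear_sym/H => //; apply: (collinear_on lk).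
Qed.

(** On a line through [w] leaving [W], the neighbour of [v] can only be [w]. *)
Lemma collinear_of_disjoint w v : W w -> ~ deep w ->
  (forall x, ~ W x -> x ⊥ w -> ~ x ⊥ v) -> w ⊥ v.
Proof.
move=> Ww nd H; have [k [x [lk kw kx Wx]]] := affine_line_at nd.
have [b kb /collinear_sym bv] := collinear_some v lk.
have [<-//|bw] := pselect (b = w).
have [Wb|/H[]//] := pselect (W b); last exact: (collinear_on lk).
by case: Wx; apply: (subspace_line subW lk bw).
Qed.

Lemma deep_perp u x : deep u -> W x -> u ⊥ x.
Proof.
move=> du Wx; apply: contrapT => ux; apply: properW.
have [k lk ku] := line_through u; have [c [kc cu _]] := third_point u u lk.
apply/seteqP; split=> //; apply: (perp_maximal_on subspaceT nondegT) ux => //.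
  by exists c; split=> //; apply: (collinear_on lk).
by move=> y _; apply: du.
Qed.

Lemma deep_unique u v : deep u -> deep v -> u = v.
Proof. by move=> du dv; apply: perp_inj => z /du; apply: deep_perp. Qed.

(* Maximality of the perp of the point k in the residue of u. *)
Lemma deep_of_perp_line k u h : line k -> k u -> k `<=` W ->
  (forall y, (forall x, k x -> y ⊥ x) -> W y) ->
  W h -> h ⊥ u -> ~ (forall x, k x -> h ⊥ x) -> deep u.
Proof.
move=> lk ku kW kpW Wh hu hk.
have [q _ uq] := nondegT (I : [set: P] u).
have sX := @subspace_perp2 _ u q subspaceT.
have nX := nondeg_perp2 subspaceT nondegT (I : [set: P] u) (I : [set: P] q) uq.
have inX l : line l -> l u -> exists b, [/\ l b, b <> u & perp2 setT u q b].
  move=> ll lu; have [b lb qb] := collinear_some q ll.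
  exists b; split=> //; first by move=> E; apply/uq/collinear_sym; rewrite -E.
  by split=> //; [apply: (collinear_on ll)|apply: collinear_sym].
have [a [ka au Xa]] := inX _ lk ku.
have [l [ll lh lu]] := hu.
have nhu : h <> u.
  by move=> E; apply: hk => x kx; rewrite E; apply: (collinear_on lk).
have [z [lz zu Xz]] := inX _ ll lu.
have Wz : W z by apply: (subspace_line subW ll nhu) => //; apply: kW.
have naz : ~ a ⊥ z.
  move=> az; apply: hk; apply: (collinear_all lk ku ka) => //; first congruence.
  apply/collinear_sym/(collinear_all ll lz lu) => //; exact: (collinear_on lk).
have XW : perp2 setT u q `<=` W.
  apply: (perp_maximal_on sX nX Xa Xz) naz => //; last first.
    move=> x [_ xu _] ax; apply: kpW; apply: (collinear_all lk ku ka) => //.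
      by congruence.
    exact: collinear_sym.
  (* A singular plane on [k] provides the neighbour of [a] in the residue that [perp_maximal_on]
     asks for. *)
  have [t kt tk] := plane_on lk; have [m [lm mt mu]] := tk _ ku.
  have tu : t <> u by move=> E; apply: kt; rewrite E.
  have [c [mc cu Xc]] := inX _ lm mu; exists c; split=> //.
    move=> ca; subst c; apply: kt; rewrite (line_eq lk lm au) //.
  apply: (collinear_all lm mt mu) => //.
    by apply: collinear_sym; apply: tk.
  exact: (collinear_on lk).
move=> s [m [lm mu ms]]; have [b [mb bu Xb]] := inX _ lm mu.
by apply: (subspace_line subW lm bu) => //; [apply: XW|apply: kW].
Qed.

Lemma deep_of_disjoint w v : (forall k, line k -> exists2 x, k x & W x) ->
  W w -> W v -> w <> v -> ~ deep w ->
  (forall x, ~ W x -> x ⊥ w -> ~ x ⊥ v) -> exists u, deep u.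
Proof.
move=> hypW Ww Wv wv nd H; apply: contrapT => N.
have [k [lk kw kv]] := collinear_of_disjoint Ww nd H.
have kW := subspace_line subW lk wv kw kv Ww Wv.
have kpW y : (forall x, k x -> y ⊥ x) -> W y.
  by move=> yk; apply: contrapT => /H; apply; apply: yk.
(* Thus [W] lies in k^perp: if [h] missed a point of [k], its neighbour [u] on [k] would be deep. *)
have Wk h x : W h -> k x -> h ⊥ x.
  move=> Wh kx; have [u ku hu] := collinear_some h lk.
  apply: contrapT => hx; apply: N; exists u.
  by apply: (deep_of_perp_line lk ku kW kpW Wh hu) => hk; apply: hx; apply: hk.
have [l [y [ll lw ly Wy]]] := affine_line_at nd.
have wy : w <> y by move=> E; apply: Wy; rewrite -E.
(* A line through y leaving w^perp misses W, which is contained in w^perp. *)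
have [t [yt wt]] : exists t, y ⊥ t /\ ~ w ⊥ t.
  apply: contrapT => E; apply/wy/esym/perp_inj => t yt.
  by apply: contrapT => wt; apply: E; exists t.
have [m [lm my mt]] := yt; have [x mx Wx] := hypW _ lm.
have xy : x <> y by move=> E; apply: Wy; rewrite -E.
apply: wt; apply: (collinear_all lm mx my) => //.
  by apply: collinear_sym; apply: Wk.
exact: (collinear_on ll).
Qed.

(** Two further points of a line through [u] serve: a common neighbour of them is collinear with
    [u], hence in [W]. *)
Lemma disjoint_of_deep u : deep u -> exists w v,
  [/\ W w, W v & w <> v] /\ [/\ ~ deep w, ~ deep v &
   forall x, ~ W x -> x ⊥ w -> ~ x ⊥ v].
Proof.
move=> du; have [k lk ku] := line_through u.
have [w [kw wu _]] := third_point u u lk; have [v [kv vu vw]] := third_point u w lk.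
exists w, v; split; split.
- by apply: du; apply: (collinear_on lk).
- by apply: du; apply: (collinear_on lk).
- by congruence.
- by move=> /deep_unique/(_ du).
- by move=> /deep_unique/(_ du).
move=> x Wx xw xv; apply/Wx/du/collinear_sym.
by apply: (collinear_all lk kw kv) => //; congruence.
Qed.

End Complement.
End PolarSpace.

(** * First-order formulas *)

Definition FOr n (f g : formula n) := FNot (FAnd (FNot f) (FNot g)).
Definition FImp n (f g : formula n) := FNot (FAnd f (FNot g)).
Definition FIff n (f g : formula n) := FAnd (FImp f g) (FImp g f).
Definition FAll n (f : formula n.+1) := FNot (FEx (FNot f)).

Section Connectives.
Variables (M : pointLine) (n : nat) (e : n.-tuple (elt M)).

Lemma holds_or f g : holds (FOr f g) e = (holds f e \/ holds g e).
Proof. by rewrite /= not_andE !not_notE. Qed.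

Lemma holds_imp f g : holds (FImp f g) e = (holds f e -> holds g e).
Proof. by rewrite /= not_andE not_notE -implyE. Qed.

Lemma holds_iff f g : holds (FIff f g) e = (holds f e <-> holds g e).
Proof. by rewrite /iff -!holds_imp. Qed.

Lemma holds_all f : holds (FAll f) e = forall x, holds f (cons_tuple x e).
Proof.
by rewrite /= -forallNE; apply: eq_forall => x; rewrite not_notE.
Qed.

End Connectives.

(** * Relations definable from incidence *)

Section Relations.
Variable M : pointLine.
Implicit Types a b c d k l m x y : elt M.

Definition adjacent x y := exists k, incident x k /\ incident y k.

(** For a line [k] meeting [W] in a point w, the negation says that [x] is collinear with w: [x]
    then has no or at least two neighbours on [k] off [W]. *)
Definition meets_once x k := exists y,
  (incident y k /\ adjacent x y) /\
  forall z, incident z k -> adjacent x z -> z = y.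

(** Singles out the lines that lose a point to [W]; the lost point acts as a direction. *)
Definition affine k := ~ is_point k /\
  exists x, is_point x /\ ~ exists y, incident y k /\ adjacent x y.

Definition parallel k l :=
  forall x, is_point x -> (meets_once x k <-> meets_once x l).

Definition no_common_neighbour k l :=
  ~ exists x, is_point x /\ (~ meets_once x k /\ ~ meets_once x l).

Definition directions_adjacent k l := no_common_neighbour k l \/
  exists m, (affine m /\ parallel k m) /\
    forall x, incident x m -> ~ meets_once x l.

(** The first clause says that [W] meets every line; it also makes [k] and [l] affine, so that they
    stand for points of [W] that are not deep. *)
Definition has_deep_point := (forall k, is_point k \/ affine k) /\
  exists k l, (~ is_point k /\ ~ is_point l) /\
    (~ parallel k l /\ no_common_neighbour k l).

(* A pair (a, b) stands for the point a if a is a point, for the point of W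
   on a if a and b are lines, and for the deep point otherwise. *)
Definition point_code a b := is_point a \/ ~ is_point a /\
  (~ is_point b /\ affine a \/ is_point b /\ has_deep_point).

(** The clauses without a condition on neighbours concern the deep point, which is adjacent to every
    point of [W] and to none off [W]. *)
Definition code_adjacent a b c d :=
  (is_point a /\ (is_point c /\ adjacent a c \/
     ~ is_point c /\ (~ is_point d /\ ~ meets_once a c))) \/
  (~ is_point a /\ (is_point c /\ (~ is_point b /\ ~ meets_once c a) \/
     ~ is_point c /\ (is_point b \/ (is_point d \/ directions_adjacent a c)))).

Definition code_equiv a b c d := forall x y, point_code x y ->
  (code_adjacent a b x y <-> code_adjacent c d x y).

Definition line_code a b c d := (point_code a b /\ point_code c d) /\
  (code_adjacent a b c d /\ ~ code_equiv a b c d).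

(** Membership in the double perp of two coded points, which is their joining line if they are
    distinct and collinear. *)
Definition code_on_line a b c d c' d' := forall x y, point_code x y ->
  code_adjacent x y c d -> code_adjacent x y c' d' -> code_adjacent x y a b.

End Relations.

(** * The corresponding formulas; [0] is the variable bound last and [^ i] shifts past one binder *)

Local Notation "0" := ord0.
Local Notation "^ i" := (lift ord0 i)
  (at level 8, right associativity, format "^ i").

Definition FAdjacent n (i j : 'I_n) := FEx (FAnd (FInc ^i 0) (FInc ^j 0)).

Definition FMeetsOnce n (i j : 'I_n) := FEx (FAnd
  (FAnd (FInc 0 ^j) (FAdjacent ^i 0))
  (FAll (FImp (FInc 0 ^^j) (FImp (FAdjacent ^^i 0) (FEq 0 ^0))))).

Definition FAffine n (i : 'I_n) := FAnd (FNot (FPoint i))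
  (FEx (FAnd (FPoint 0)
     (FNot (FEx (FAnd (FInc 0 ^^i) (FAdjacent ^0 0)))))).

Definition FParallel n (i j : 'I_n) :=
  FAll (FImp (FPoint 0) (FIff (FMeetsOnce 0 ^i) (FMeetsOnce 0 ^j))).

Definition FNoCommonNeighbour n (i j : 'I_n) := FNot (FEx (FAnd (FPoint 0)
  (FAnd (FNot (FMeetsOnce 0 ^i)) (FNot (FMeetsOnce 0 ^j))))).

Definition FDirectionsAdjacent n (i j : 'I_n) := FOr (FNoCommonNeighbour i j)
  (FEx (FAnd (FAnd (FAffine 0) (FParallel ^i 0))
    (FAll (FImp (FInc 0 ^0) (FNot (FMeetsOnce 0 ^^j)))))).

Definition FHasDeepPoint n : formula n :=
  FAnd (FAll (FOr (FPoint 0) (FAffine 0)))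
  (FEx (FEx (FAnd (FAnd (FNot (FPoint ^0)) (FNot (FPoint 0)))
     (FAnd (FNot (FParallel ^0 0)) (FNoCommonNeighbour ^0 0))))).

Definition FPointCode n (i j : 'I_n) := FOr (FPoint i) (FAnd (FNot (FPoint i))
  (FOr (FAnd (FNot (FPoint j)) (FAffine i))
       (FAnd (FPoint j) (FHasDeepPoint n)))).

Definition FCodeAdjacent n (i j i' j' : 'I_n) :=
  FOr (FAnd (FPoint i) (FOr (FAnd (FPoint i') (FAdjacent i i'))
     (FAnd (FNot (FPoint i')) (FAnd (FNot (FPoint j')) (FNot (FMeetsOnce i i'))))))
  (FAnd (FNot (FPoint i)) (FOr
     (FAnd (FPoint i') (FAnd (FNot (FPoint j)) (FNot (FMeetsOnce i' i))))
     (FAnd (FNot (FPoint i'))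
        (FOr (FPoint j) (FOr (FPoint j') (FDirectionsAdjacent i i')))))).

Definition FCodeEquiv n (i j i' j' : 'I_n) := FAll (FAll (FImp (FPointCode ^0 0)
  (FIff (FCodeAdjacent ^^i ^^j ^0 0) (FCodeAdjacent ^^i' ^^j' ^0 0)))).

Definition FLineCode n (i j i' j' : 'I_n) :=
  FAnd (FAnd (FPointCode i j) (FPointCode i' j'))
       (FAnd (FCodeAdjacent i j i' j') (FNot (FCodeEquiv i j i' j'))).

Definition FCodeOnLine n (i j i1 j1 i2 j2 : 'I_n) :=
  FAll (FAll (FImp (FPointCode ^0 0)
    (FImp (FCodeAdjacent ^0 0 ^^i1 ^^j1)
    (FImp (FCodeAdjacent ^0 0 ^^i2 ^^j2) (FCodeAdjacent ^0 0 ^^i ^^j))))).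


(** * Each formula expresses its relation *)

Section Semantics.
Variables (M : pointLine).

Let holds_and n (e : n.-tuple (elt M)) f g :
  holds (FAnd f g) e = (holds f e /\ holds g e).
Proof. by []. Qed.

Let holds_not n (e : n.-tuple (elt M)) f : holds (FNot f) e = ~ holds f e.
Proof. by []. Qed.

Let holds_ex n (e : n.-tuple (elt M)) f :
  holds (FEx f) e = exists x, holds f (cons_tuple x e).
Proof. by []. Qed.

Let holds_point n (e : n.-tuple (elt M)) i :
  holds (FPoint i) e = is_point (tnth e i).
Proof. by []. Qed.

Let holds_eq n (e : n.-tuple (elt M)) i j :
  holds (FEq i j) e = (tnth e i = tnth e j).
Proof. by []. Qed.

Let holds_inc n (e : n.-tuple (elt M)) i j :
  holds (FInc i j) e = incident (tnth e i) (tnth e j).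
Proof. by []. Qed.

(* The derived connectives come first: they unfold to primitive ones. *)
Let holdsE := (holds_or, holds_imp, holds_iff, holds_all,
  holds_and, holds_not, holds_ex, holds_point, holds_eq, holds_inc).

(** Plain rewriting does not reach terms with bound variables, so both sides are taken apart
    connective by connective, with [rw] run at each level. *)
Ltac under_binders rw := rw; try done; lazymatch goal with
  | |- (exists _, _) = _ => apply: eq_exists => ?; under_binders rw
  | |- (?A -> ?B) = _ => congr (_ -> _); under_binders rw
  | |- (forall _, _) = _ => apply: eq_forall => ?; under_binders rw
  | |- (_ /\ _) = _ => congr (_ /\ _); under_binders rw
  | |- (_ \/ _) = _ => congr (_ \/ _); under_binders rw
  | |- (~ _) = _ => congr (~ _); under_binders rw
  end.

Lemma holds_adjacent n (e : n.-tuple (elt M)) i j :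
  holds (FAdjacent i j) e = adjacent (tnth e i) (tnth e j).
Proof.
by rewrite /FAdjacent /adjacent;
  under_binders ltac:(rewrite ?holdsE ?(tnthS, tnth0)).
Qed.

Lemma holds_meets_once n (e : n.-tuple (elt M)) i j :
  holds (FMeetsOnce i j) e = meets_once (tnth e i) (tnth e j).
Proof.
by rewrite /FMeetsOnce /meets_once; under_binders ltac:(rewrite
  ?(holds_adjacent, holdsE) ?(tnthS, tnth0)).
Qed.

Lemma holds_affine n (e : n.-tuple (elt M)) i :
  holds (FAffine i) e = affine (tnth e i).
Proof.
by rewrite /FAffine /affine; under_binders ltac:(rewrite
  ?(holds_adjacent, holdsE) ?(tnthS, tnth0)).
Qed.

Lemma holds_parallel n (e : n.-tuple (elt M)) i j :
  holds (FParallel i j) e = parallel (tnth e i) (tnth e j).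
Proof.
by rewrite /FParallel /parallel; under_binders ltac:(rewrite
  ?(holds_meets_once, holdsE) ?(tnthS, tnth0)).
Qed.

Lemma holds_no_common_neighbour n (e : n.-tuple (elt M)) i j :
  holds (FNoCommonNeighbour i j) e = no_common_neighbour (tnth e i) (tnth e j).
Proof.
by rewrite /FNoCommonNeighbour /no_common_neighbour;
  under_binders ltac:(rewrite
  ?(holds_meets_once, holdsE) ?(tnthS, tnth0)).
Qed.

Lemma holds_directions_adjacent n (e : n.-tuple (elt M)) i j :
  holds (FDirectionsAdjacent i j) e = directions_adjacent (tnth e i) (tnth e j).
Proof.
by rewrite /FDirectionsAdjacent /directions_adjacent; under_binders ltac:(rewrite
  ?(holds_no_common_neighbour, holds_affine, holds_parallel, holds_meets_once,
    holdsE) ?(tnthS, tnth0)).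
Qed.

Lemma holds_has_deep_point n (e : n.-tuple (elt M)) :
  holds (FHasDeepPoint n) e = has_deep_point M.
Proof.
by rewrite /FHasDeepPoint /has_deep_point; under_binders ltac:(rewrite
  ?(holds_no_common_neighbour, holds_affine, holds_parallel, holdsE)
  ?(tnthS, tnth0)).
Qed.

Lemma holds_point_code n (e : n.-tuple (elt M)) i j :
  holds (FPointCode i j) e = point_code (tnth e i) (tnth e j).
Proof.
by rewrite /FPointCode /point_code; under_binders ltac:(rewrite
  ?(holds_has_deep_point, holds_affine, holdsE) ?(tnthS, tnth0)).
Qed.

Lemma holds_code_adjacent n (e : n.-tuple (elt M)) i j i' j' :
  holds (FCodeAdjacent i j i' j') e =
  code_adjacent (tnth e i) (tnth e j) (tnth e i') (tnth e j').
Proof.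
by rewrite /FCodeAdjacent /code_adjacent; under_binders ltac:(rewrite
  ?(holds_adjacent, holds_meets_once, holds_directions_adjacent, holdsE)
  ?(tnthS, tnth0)).
Qed.

Lemma holds_code_equiv n (e : n.-tuple (elt M)) i j i' j' :
  holds (FCodeEquiv i j i' j') e =
  code_equiv (tnth e i) (tnth e j) (tnth e i') (tnth e j').
Proof.
by rewrite /FCodeEquiv /code_equiv; under_binders ltac:(rewrite
  ?(holds_point_code, holds_code_adjacent, holdsE) ?(tnthS, tnth0)).
Qed.

Lemma holds_line_code n (e : n.-tuple (elt M)) i j i' j' :
  holds (FLineCode i j i' j') e =
  line_code (tnth e i) (tnth e j) (tnth e i') (tnth e j').
Proof.
by rewrite /FLineCode /line_code; under_binders ltac:(rewrite
  ?(holds_point_code, holds_code_adjacent, holds_code_equiv, holdsE)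
  ?(tnthS, tnth0)).
Qed.

Lemma holds_code_on_line n (e : n.-tuple (elt M)) i j i1 j1 i2 j2 :
  holds (FCodeOnLine i j i1 j1 i2 j2) e =
  code_on_line (tnth e i) (tnth e j) (tnth e i1) (tnth e j1)
    (tnth e i2) (tnth e j2).
Proof.
by rewrite /FCodeOnLine /code_on_line; under_binders ltac:(rewrite
  ?(holds_point_code, holds_code_adjacent, holdsE) ?(tnthS, tnth0)).
Qed.
End Semantics.

(** * Recovering the polar space *)

(** [a], [b], [c] are taken from [X 0], from [X 1] off [X 0], and from [X 2] off [X 1]; the line ab
    stays in [X 1] and so misses [c]. *)
Lemma singular_triangle (P : pointLine) n : has_rank P n -> (3 <= n)%N ->
  exists k a b c, [/\ @line P k, k a, k b & a <> b] /\
    [/\ ~ k c, collinear c a & collinear c b].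
Proof.
move=> [[X [HX pX]] _] n3.
have [[a Xa] _ _] := HX 0%N (ltnW (ltnW n3)).
have [_ sX1 gX1] := HX 1%N (ltnW n3).
have [_ sX2 gX2] := HX 2%N n3.
have [X01 nX10] := pX 0%N (ltnW n3); have [X12 nX21] := pX 1%N n3.
have [b X1b nX0b] : exists2 b, X 1%N b & ~ X 0%N b.
  apply: contrapT => N; apply: nX10 => b X1b; apply: contrapT => nX0b; apply: N.
  by exists b.
have [c X2c nX1c] : exists2 c, X 2%N c & ~ X 1%N c.
  apply: contrapT => N; apply: nX21 => c X2c; apply: contrapT => nX1c; apply: N.
  by exists c.
have ab : a <> b by move=> E; apply: nX0b; rewrite -E.
have [k [lk ka kb]] := gX1 _ _ (X01 _ Xa) X1b ab.
have X1k : k `<=` X 1%N by apply: (subspace_line sX1 lk ab) => //; apply: X01.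
exists k, a, b, c; split; split=> //.
- by move=> /X1k.
- apply: gX2 => //; first by apply/X12/X01.
  by move=> E; apply: nX1c; rewrite E; apply: X01.
- apply: gX2 => //; first by apply/X12.
  by move=> E; apply: nX1c; rewrite E.
Qed.

(** * Meaning of the relations in the complement of [W] *)

Section Recovery.
Variables (P : pointLine) (W : set P).
Hypothesis polarP : polar_space P.
Hypothesis thickP : thick P.
Hypothesis reflP : forall x : P, collinear x x.
Hypothesis nondegP : nondegenerate P.
Hypothesis planeP : exists p : P, on_plane p.
Hypothesis subW : subspace W.
Hypothesis properW : W <> setT.

Local Notation M := (complement W).
Implicit Types (p q w v x y : P) (k l K L : set P).

Lemma trace_line K : line K -> ~ (K `<=` W) -> @line M [set x | K (val x)].
Proof. by move=> lK KW; exists K. Qed.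

Definition lin K (lK : line K) (KW : ~ (K `<=` W)) : elt M :=
  inr (SigSub (mem_set (trace_line lK KW))).

Definition pnt x (Wx : ~ W x) : elt M := inl (SigSub (mem_set (Wx : (~` W) x))).

Lemma lineP (k : elt M) : ~ is_point k ->
  exists K (lK : line K) (KW : ~ (K `<=` W)), k = lin lK KW.
Proof.
case: k => [x []//|[k mk] _]; have := set_mem mk; move=> [K [lK KW kE]].
by exists K, lK, KW; subst k; congr inr; apply: val_inj.
Qed.

Lemma pointP (x : elt M) : is_point x -> exists p (Wp : ~ W p), x = pnt Wp.
Proof.
case: x => [[p mp] _|//]; exists p, (set_mem mp); congr inl; exact: val_inj.
Qed.

Lemma pnt_inj x y (Wx : ~ W x) (Wy : ~ W y) : pnt Wx = pnt Wy -> x = y.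
Proof. by case. Qed.

Lemma pnt_eq x y (Wx : ~ W x) (Wy : ~ W y) : x = y -> pnt Wx = pnt Wy.
Proof. by move=> E; subst y; congr inl; apply: val_inj. Qed.

Lemma incident_lin (y : elt M) K (lK : line K) (KW : ~ (K `<=` W)) :
  incident y (lin lK KW) -> exists p (Wp : ~ W p), y = pnt Wp /\ K p.
Proof.
move=> iy; have /pointP[p [Wp yE]] : is_point y by case: y iy.
by exists p, Wp; split=> //; subst y.
Qed.

Lemma adjacentE x y (Wx : ~ W x) (Wy : ~ W y) :
  adjacent (pnt Wx) (pnt Wy) <-> x ⊥ y.
Proof.
split=> [[k []]|[K [lK Kx Ky]]].
  have [/pointP[z [Wz ->]]//|/lineP[K [lK [KW ->]]] Kx Ky] := pselect (is_point k).
  by exists K.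
have KW : ~ (K `<=` W) by move=> /(_ _ Kx).
by exists (lin lK KW).
Qed.

Lemma line_off K w x : line K -> K w -> W w -> ~ (K `<=` W) -> K x -> x <> w ->
  ~ W x.
Proof.
move=> lK Kw Ww KW Kx xw Wx; apply: KW.
exact: (subspace_line subW lK xw).
Qed.

(** If [x] is not collinear with [w], its unique neighbour on [K] is off [W]. If it is, a neighbour
    other than [w] makes all of [K] neighbours, and thickness leaves a second one off [W]. *)
Lemma meets_onceE x (Wx : ~ W x) K (lK : line K) (KW : ~ (K `<=` W)) w :
  K w -> W w -> ~ meets_once (pnt Wx) (lin lK KW) <-> x ⊥ w.
Proof.
move=> Kw Ww; have off y := line_off (x := y) lK Kw Ww KW.
split=> [N|xw [y [[/incident_lin[p [Wp [-> Kp]]] /adjacentE xp] uy]]].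
  apply: contrapT => nxw; apply: N.
  have [b Kb xb] := collinear_some polarP x lK.
  have bw : b <> w by move=> E; apply: nxw; rewrite -E.
  exists (pnt (off _ Kb bw)); split; first by split=> //; apply/adjacentE.
  move=> z /incident_lin[p [Wp [-> Kp]]] /adjacentE xp; apply: pnt_eq.
  apply: contrapT => pb; apply: nxw.
  exact: (collinear_all polarP lK Kp Kb pb).
have pw : p <> w by move=> E; have := Wp; rewrite E.
have [c [Kc cp cw]] := third_point thickP p w lK.
apply: cp; apply: (@pnt_inj _ _ (off _ Kc cw) Wp); apply: uy => //.
by apply/adjacentE; apply: (collinear_all polarP lK Kp Kw pw).
Qed.

Lemma affineE K (lK : line K) (KW : ~ (K `<=` W)) :
  affine (lin lK KW) <-> exists2 w, K w & W w.
Proof.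
split=> [[_ [_ [/pointP[x [Wx ->]] N]]]|[w Kw Ww]].
  have [b Kb xb] := collinear_some polarP x lK; exists b => //.
  apply: contrapT => Wb; apply: N; exists (pnt Wb); split=> //.
  exact/adjacentE.
have [x Kx Wx] : exists2 x, K x & ~ W x.
  apply: contrapT => N; apply: KW => x Kx; apply: contrapT => Wx; apply: N.
  by exists x.
have [y [Wy yw yK]] := affine_witness polarP thickP reflP nondegP planeP subW
  lK Kw Ww Kx Wx.
split=> //; exists (pnt Wy); split=> // -[_ [/incident_lin[p [Wp [-> Kp]]]]].
by move=> /adjacentE; apply: yK.
Qed.

Lemma not_deep_on K w : line K -> ~ (K `<=` W) -> K w -> ~ deep W w.
Proof. by move=> lK KW Kw dw; apply: KW => x Kx; apply: dw; exists K. Qed.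

Lemma parallelE K (lK : line K) (KW : ~ (K `<=` W)) L (lL : line L)
    (LW : ~ (L `<=` W)) w v : K w -> W w -> L v -> W v ->
  parallel (lin lK KW) (lin lL LW) <-> w = v.
Proof.
move=> Kw Ww Lv Wv; split=> [par|E].
  apply: (perp_off_inj polarP thickP reflP nondegP planeP subW) => //.
    exact: not_deep_on Kw.
  move=> x Wx; have {}par := par (pnt Wx) I.
  split=> [/(meets_onceE Wx lK KW Kw Ww)|/(meets_onceE Wx lL LW Lv Wv)] N.
    by apply/(meets_onceE Wx lL LW Lv Wv) => /par.
  by apply/(meets_onceE Wx lK KW Kw Ww) => /par.
subst v => _ /pointP[x [Wx ->]].
have A := meets_onceE Wx lK KW Kw Ww; have B := meets_onceE Wx lL LW Lv Wv.
by split=> H; apply: contrapT => /A/B || apply: contrapT => /B/A.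
Qed.

Lemma no_common_neighbourE K (lK : line K) (KW : ~ (K `<=` W)) L (lL : line L)
    (LW : ~ (L `<=` W)) w v : K w -> W w -> L v -> W v ->
  no_common_neighbour (lin lK KW) (lin lL LW) <->
  forall x, ~ W x -> x ⊥ w -> ~ x ⊥ v.
Proof.
move=> Kw Ww Lv Wv; split=> [N x Wx xw xv|H].
  apply: N; exists (pnt Wx); split=> //; split.
    exact/(meets_onceE Wx lK KW Kw Ww).
  exact/(meets_onceE Wx lL LW Lv Wv).
move=> [_ [/pointP[x [Wx ->]] []]].
by move=> /(meets_onceE Wx lK KW Kw Ww)/(H x Wx) N /(meets_onceE Wx lL LW Lv Wv).
Qed.

(** For collinear [w] and [v] with a common neighbour [x] off [W], the line xw lies in v^perp.
    Conversely, a line through [w] with two points off [W] collinear with [v] makes [w] collinear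
    with [v]. *)
Lemma directions_adjacentE K (lK : line K) (KW : ~ (K `<=` W)) L (lL : line L)
    (LW : ~ (L `<=` W)) w v : K w -> W w -> L v -> W v ->
  directions_adjacent (lin lK KW) (lin lL LW) <-> w ⊥ v.
Proof.
move=> Kw Ww Lv Wv; split=> [[|[m [[am]]]]|wv].
- move=> /(no_common_neighbourE lK KW lL LW Kw Ww Lv Wv).
  by apply: (collinear_of_disjoint polarP subW) => //; apply: not_deep_on Kw.
- have [/lineP[N [lN [NW mE]]] _] := am; subst m.
  have /affineE[u Nu Wu] := am.
  move=> /(parallelE lK KW lN NW Kw Ww Nu Wu) E; subst u => H.
  have [x [Nx xw _]] := third_point thickP w w lN.
  have [y [Ny yw yx]] := third_point thickP w x lN.
  have off z := line_off (x := z) lN Nu Wu NW.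
  have vN z : N z -> z <> w -> v ⊥ z.
    move=> Nz zw; apply: collinear_sym.
    by apply/(meets_onceE (off z Nz zw) lL LW Lv Wv); apply: H.
  by apply/collinear_sym/(collinear_all polarP lN Nx Ny) => //; auto.
have [N|N] := pselect (no_common_neighbour (lin lK KW) (lin lL LW)); first by left.
right; have [x [Wx [xw xv]]] : exists x, ~ W x /\ (x ⊥ w /\ x ⊥ v).
  apply: contrapT => E; apply/N/(no_common_neighbourE lK KW lL LW Kw Ww Lv Wv).
  by move=> x Wx xw xv; apply: E; exists x.
have [N' [lN Nx Nw]] := xw; have NW : ~ (N' `<=` W) by move=> /(_ _ Nx).
have nxw : x <> w by move=> E; apply: Wx; rewrite E.
exists (lin lN NW); split; first split.
- by apply/affineE; exists w.
- exact/(parallelE lK KW lN NW Kw Ww Nw Ww).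
move=> _ /incident_lin[y [Wy [-> Ny]]]; apply/(meets_onceE Wy lL LW Lv Wv).
apply: collinear_sym; apply: (collinear_all polarP lN Nx Nw nxw) => //.
  exact: collinear_sym.
exact: collinear_sym.
Qed.

Lemma has_deep_pointE : has_deep_point M <-> exists u, deep W u.
Proof.
split=> [[aff [_ [_ [[/lineP[K [lK [KW ->]]] /lineP[L [lL [LW ->]]]] [par ncn]]]]]|
         [u du]].
  have [//|/affineE[w Kw Ww]] := aff (lin lK KW).
  have [//|/affineE[v Lv Wv]] := aff (lin lL LW).
  apply: (deep_of_disjoint polarP thickP reflP nondegP planeP subW _ Ww Wv).
  (* Lines inside [W] are invisible in the complement, but they meet [W] trivially. *)
  - move=> N lN; have [NW|NW] := pselect (N `<=` W); last first.
      by have [//|/affineE[x Nx Wx]] := aff (lin lN NW); exists x.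
    by have [x [Nx _ _]] := third_point thickP w w lN; exists x => //; apply: NW.
  - by move=> wv; apply/par/(parallelE lK KW lL LW Kw Ww Lv Wv).
  - exact: not_deep_on Kw.
  - exact/(no_common_neighbourE lK KW lL LW Kw Ww Lv Wv).
have [w [v [[Ww Wv wv] [dw dv H]]]] :=
  disjoint_of_deep polarP thickP reflP nondegP subW properW du.
have [K [x [lK Kw Kx Wx]]] := affine_line_at dw.
have [L [y [lL Lv Ly Wy]]] := affine_line_at dv.
have KW : ~ (K `<=` W) by move=> /(_ _ Kx).
have LW : ~ (L `<=` W) by move=> /(_ _ Ly).
split=> [k|].
  have [|/lineP[N [lN [NW ->]]]] := pselect (is_point k); first by left.
  right; apply/affineE; have [b Nb ub] := collinear_some polarP u lN.
  by exists b => //; apply: du.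
exists (lin lK KW), (lin lL LW); split; first by split; case. 
split.
  by move=> /(parallelE lK KW lL LW Kw Ww Lv Wv).
exact/(no_common_neighbourE lK KW lL LW Kw Ww Lv Wv).
Qed.

(** In the deep case [K] is an arbitrary line leaving [W]: only the sorts of the two entries
    matter. *)
Inductive represents : elt M -> elt M -> P -> Prop :=
| represents_pnt x (Wx : ~ W x) b : represents (pnt Wx) b x
| represents_direction K (lK : line K) (KW : ~ (K `<=` W)) b w :
    ~ is_point b -> K w -> W w -> represents (lin lK KW) b w
| represents_deep K (lK : line K) (KW : ~ (K `<=` W)) b u :
    is_point b -> deep W u -> represents (lin lK KW) b u.

Lemma represents_surj p : exists a b, represents a b p.
Proof.
have [Wp|Wp] := pselect (W p); last by do 2!exists (pnt Wp); constructor.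
have [dp|/affine_line_at[K [x [lK Kp Kx Wx]]]] := pselect (deep W p); last first.
  have KW : ~ (K `<=` W) by move=> /(_ _ Kx).
  by do 2!exists (lin lK KW); constructor.
have [x Wx] : exists x, ~ W x.
  apply: contrapT => N; apply: properW; apply/seteqP; split=> // x _.
  by apply: contrapT => Wx; apply: N; exists x.
have [K lK Kx] := line_through reflP x.
have KW : ~ (K `<=` W) by move=> /(_ _ Kx).
by exists (lin lK KW), (pnt Wx); constructor.
Qed.

Lemma point_codeE (a b : elt M) : point_code a b <-> exists p, represents a b p.
Proof.
split=> [|[p []]]; last 3 first.
- by move=> x Wx c; left.
- move=> K lK KW c w nc Kw Ww; right; split=> //; left; split=> //.
  by apply/affineE; exists w.
- move=> K lK KW c u pc du; right; split=> //; right; split=> //.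
  by apply/has_deep_pointE; exists u.
move=> [/pointP[x [Wx ->]]|[/lineP[K [lK [KW ->]]] [[nb /affineE[w Kw Ww]]|]]].
- by exists x; constructor.
- by exists w; constructor.
- by move=> [pb /has_deep_pointE[u du]]; exists u; constructor.
Qed.

Lemma code_adjacentE (a b c d : elt M) p q :
  represents a b p -> represents c d q -> code_adjacent a b c d <-> p ⊥ q.
Proof.
have deepW u x : deep W u -> W x -> u ⊥ x by apply: deep_perp.
have Wdeep u : deep W u -> W u by apply.
case=> [x Wx b'|K lK KW b' w nb Kw Ww|K lK KW b' u pb du];
case=> [y Wy d'|L lL LW d' v nd Lv Wv|L lL LW d' v pd dv];
rewrite /code_adjacent /=.
- rewrite -(adjacentE Wx Wy); tauto.
- rewrite -(meets_onceE Wx lL LW Lv Wv); tauto.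
- split; first by tauto.
  by move=> /collinear_sym/dv.
- rewrite (propext (conj (@collinear_sym _ w y) (@collinear_sym _ y w))).
  rewrite -(meets_onceE Wy lK KW Kw Ww); tauto.
- rewrite -(directions_adjacentE lK KW lL LW Kw Ww Lv Wv); tauto.
- split; last by tauto.
  by move=> _; apply/collinear_sym/deepW.
- split; first by tauto.
  by move/du.
- split; last by tauto.
  by move=> _; apply: deepW.
- split; last by tauto.
  by move=> _; apply: deepW => //; apply: Wdeep.
Qed.

Lemma code_equivE (a b c d : elt M) p q :
  represents a b p -> represents c d q -> code_equiv a b c d <-> p = q.
Proof.
move=> ap cq; split=> [eqv|pq]; last first.
  subst q => x y /point_codeE[z xz].
  by rewrite (code_adjacentE ap xz) (code_adjacentE cq xz).
apply: (perp_inj polarP reflP nondegP) => z pz.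
have [x [y xz]] := represents_surj z.
have xy : point_code x y by apply/point_codeE; exists z.
by apply/(code_adjacentE cq xz)/(eqv x y xy)/(code_adjacentE ap xz).
Qed.

(** [code_equiv] is reflexive by its form, so [code_equivE] applies to a single code taken twice. *)
Lemma represents_fun (a b : elt M) p q :
  represents a b p -> represents a b q -> p = q.
Proof. by move=> ap aq; apply/(code_equivE ap aq) => x y _. Qed.

Lemma code_on_lineE (a b c d c' d' : elt M) r p q k :
  represents a b r -> represents c d p -> represents c' d' q ->
  line k -> k p -> k q -> p <> q ->
  code_on_line a b c d c' d' <-> k r.
Proof.
move=> ar cp cq lk kp kq pq; split=> [on|kr].
  apply: (line_perp_perp polarP reflP nondegP lk kp kq pq) => z zp zq.
  have [x [y xz]] := represents_surj z.
  have xy : point_code x y by apply/point_codeE; exists z.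
  apply/(code_adjacentE xz ar)/on => //.
    exact/(code_adjacentE xz cp).
  exact/(code_adjacentE xz cq).
move=> x y /point_codeE[z xz].
move=> /(code_adjacentE xz cp) zp /(code_adjacentE xz cq) zq.
by apply/(code_adjacentE xz ar); apply: (collinear_all polarP lk kp kq).
Qed.

End Recovery.

(** * The interpretation and the isomorphism *)

Local Notation i0 := (@ord0 1).
Local Notation i1 := (@ord_max 1).

(** A point is coded by a pair, a line by the codes of two of its points; the shifts pick entries of
    concatenated tuples. *)
Definition recovery := @Interpretation 2 (2 + 2)
  (FPointCode i0 i1)
  (FCodeEquiv (lshift 2 i0) (lshift 2 i1) (rshift 2 i0) (rshift 2 i1))
  (FLineCode (lshift 2 i0) (lshift 2 i1) (rshift 2 i0) (rshift 2 i1))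
  (FCodeOnLine (lshift (2 + 2) i0) (lshift (2 + 2) i1)
     (rshift 2 (lshift 2 i0)) (rshift 2 (lshift 2 i1))
     (rshift 2 (rshift 2 i0)) (rshift 2 (rshift 2 i1))).

Theorem theorem3p11 :
  exists I : interpretation,
    forall (P : pointLine) (n : nat) (W : set P),
      polar_space P -> thick P -> nondegenerate P -> embeddable P ->
      has_rank P n -> (3 <= n)%N ->
      subspace W -> W <> setT ->
      (exists H : set P, hyperplane H /\ W `<=` H) ->
      isomorphic (interpreted I (complement W)) P.
Proof.
exists recovery => P n W polarP thickP nondegP _ rankP n3 subW properW _.
have [k0 [a0 [b0 [c0 [[lk0 ka0 kb0 ab0] [kc0 ca0 cb0]]]]]] :=
  singular_triangle rankP n3.
(* Reflexivity amounts to a line through [x], which joins [x] to its neighbour on [k0]. *)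
have reflP (x : P) : collinear x x.
  by have [b kb [l [ll lx _]]] := collinear_some polarP x lk0; exists l.
have planeP : exists p : P, on_plane p.
  exists c0, k0 => //; split=> //.
  exact: (collinear_all polarP lk0 ka0 kb0 ab0).
set M := complement W; set I := recovery.
pose rep (s : 2.-tuple (elt M)) p := represents (tnth s i0) (tnth s i1) p.
have rep_surj p : exists s, rep s p.
  have [a [b ab]] := represents_surj reflP properW p.
  by exists [tuple a; b].
have rep_fun s p q : rep s p -> rep s q -> p = q.
  exact: (represents_fun polarP thickP reflP nondegP planeP subW properW).
have domE s : holds (pt_dom I) s <-> exists p, rep s p.
  rewrite holds_point_code.
  exact: (point_codeE polarP thickP reflP nondegP planeP subW properW).
have equivE s t p q : rep s p -> rep t q ->
    holds (pt_equiv I) (cat_tuple s t) <-> p = q.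
  move=> sp tq; rewrite holds_code_equiv !tnth_lshift !tnth_rshift.
  exact: (code_equivE polarP thickP reflP nondegP planeP subW properW).
have classE s t p : rep s p -> pt_class (I := I) s t <-> rep t p.
  move=> sp; split=> [[/domE[q tq] /(equivE _ _ _ _ sp tq) E]|tp].
    by rewrite E.
  by split; [apply/domE; exists p|apply/(equivE _ _ _ _ sp tp)].
pose N := interpreted I M.
(* [f] sends a class of codes to the point they all represent, and [g] sends a point to the class of
   all its codes. *)
have /choice[f fP] : forall C : N, exists p, forall s, val C s <-> rep s p.
  move=> [C mC]; have [s /domE[p sp] CE] := set_mem mC.
  by exists p => t; rewrite /= CE; apply: classE.
have /choice[g gP] : forall p, exists C : N, forall s, val C s <-> rep s p.
  move=> p; have [s sp] := rep_surj p.
  have mC : [set C | exists2 s, holds (pt_dom I) s & C = pt_class (I := I) s]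
      (pt_class (I := I) s).
    by exists s => //; apply/domE; exists p.
  by exists (SigSub (mem_set mC)) => t; apply: classE.
have fK : cancel f g.
  move=> C; apply: val_inj; apply/seteqP; split=> s.
    by move/gP/fP.
  by move/fP/gP.
have gK : cancel g f.
  move=> p; have [s sp] := rep_surj p.
  by apply: (rep_fun s) => //; apply/fP/gP.
exists f; split; first by exists g.
(* Through [f], the interpreted line coded by [u] is the line joining the two points whose codes
   make up [u]. *)
have linesE u p q K : represents (tnth u (lshift 2 i0)) (tnth u (lshift 2 i1)) p ->
    represents (tnth u (rshift 2 i0)) (tnth u (rshift 2 i1)) q ->
    line K -> K p -> K q -> p <> q ->
    forall C : N, (exists2 s, val C s & holds (pt_on_ln I) (cat_tuple s u)) <->
      K (f C).
  move=> up uq lK Kp Kq pq C.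
  have on s : rep s (f C) -> holds (pt_on_ln I) (cat_tuple s u) <-> K (f C).
    move=> sC; rewrite holds_code_on_line !tnth_lshift !tnth_rshift.
    exact: (code_on_lineE polarP thickP reflP nondegP planeP subW properW sC up uq).
  split=> [[s /fP sC /(on _ sC)]//|KC].
  by have [s sC] := rep_surj (f C); exists s; [apply/fP|apply/on].
move=> k; split=> [[u]|lK].
  rewrite holds_line_code => -[[]].
  move=> /(point_codeE polarP thickP reflP nondegP planeP subW properW)[p up].
  move=> /(point_codeE polarP thickP reflP nondegP planeP subW properW)[q uq].
  rewrite (code_adjacentE polarP thickP reflP nondegP planeP subW properW up uq).
  rewrite (code_equivE polarP thickP reflP nondegP planeP subW properW up uq).
  move=> [[K [lK Kp Kq]] pq] ->.
  suff -> : f @` [set C | exists2 s, val C s &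
      holds (pt_on_ln I) (cat_tuple s u)] = K by [].
  apply/seteqP; split=> [_ [C /(linesE _ _ _ _ up uq lK Kp Kq pq) KC <-]//|x Kx].
  by exists (g x) => //; apply/(linesE _ _ _ _ up uq lK Kp Kq pq); rewrite gK.
(* Codes of any two distinct points of the image line form a code of [k]. *)
have [[_ two] _] := polarP; have [p [q [Kp Kq pq]]] := two _ lK.
have [s sp] := rep_surj p; have [t tq] := rep_surj q.
have up : represents (tnth (cat_tuple s t) (lshift 2 i0))
    (tnth (cat_tuple s t) (lshift 2 i1)) p by rewrite !tnth_lshift.
have uq : represents (tnth (cat_tuple s t) (rshift 2 i0))
    (tnth (cat_tuple s t) (rshift 2 i1)) q by rewrite !tnth_rshift.
exists (cat_tuple s t).
  rewrite holds_line_code; split; first split.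
  - by apply/(point_codeE polarP thickP reflP nondegP planeP subW properW);
      exists p.
  - by apply/(point_codeE polarP thickP reflP nondegP planeP subW properW);
      exists q.
  rewrite (code_adjacentE polarP thickP reflP nondegP planeP subW properW up uq).
  rewrite (code_equivE polarP thickP reflP nondegP planeP subW properW up uq).
  by split=> //; exists (f @` k).
apply/seteqP; split=> C.
  by move=> kC; apply/(linesE _ _ _ _ up uq lK Kp Kq pq); exists C.
by move=> /(linesE _ _ _ _ up uq lK Kp Kq pq)[D kD /(can_inj fK) <-].
Qed.
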